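(* Consider Algorithm RMNTR with levels $0,\dots,r$, and assume that it is called at the uppermost level with $\epsilon_r^h=0$. Then $$\liminf_{k\to\infty}h_{r,k}=0 .$$
   Context: If the algorithm terminates at level $r$ at some iteration $k$, use the convention $h_{r,\ell}=h_{r,k}$ for $\ell\ge k$. Problem and hierarchy. Levels $i=0,\dots,r$ with dimensions $n_0\le\dots\le n_r=n$. At level $i$ there is $F_i=f_i+\phi_i$ on $\mathbb{R}^{n_i}$; $F_r=F=f+\phi$ is the function to be minimized. Each $F_i$ satisfies: $\phi_i:\mathbb{R}^{n_i}\to(-\infty,\infty]$ is proper, closed, convex; $f_i$ is Fréchet differentiable with Lipschitz gradient on an open set containing $\operatorname{dom}\phi_i$; $F_i$ is bounded below on $\operatorname{dom}\phi_i$; the Hessian $\nabla^2f_i(x)$ (assumed to exist) and its self-adjoint approximation $B_i(x)$ satisfy $1+\max\{\|\nabla^2f_i(x)\|,\|B_i(x)\|\}\le\kappa_H$ for all $x$, with a constant $\kappa_H\ge1$. For $i\ge1$, the restriction $R_i^{i-1}\in\mathbb{R}^{n_{i-1}\times n_i}$ is full rank with $R_i^{i-1}(R_i^{i-1})^\top=I$, and the prolongation is $P_{i-1}^i=(R_i^{i-1})^\top$. Level norms are $\|s\|_i=\sqrt{\langle s,M_is\rangle}$ with $M_r=I$, $M_i=(P_{r-1}^r\cdots P_i^{i+1})^\top(P_{r-1}^r\cdots P_i^{i+1})$ for $i<r$ (hence Euclidean). Lower-level functions: $f_{i-1}(y)=f_i(y_1,\dots,y_{n_{i-1}},0,\dots,0)$,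 and, when level $i-1$ is called from $x_{i,k}$ with $x_{i-1,0}=R_i^{i-1}x_{i,k}$, $\phi_{i-1}(y)=\phi_i(x_{i,k}+(R_i^{i-1})^\top(y-x_{i-1,0}))$. The objective at level $r$ is $L_r=F_r$, and at level $i-1$ it is $$L_{i-1}(x_{i-1,0}+s)=F_{i-1}(x_{i-1,0}+s)+\langle R_i^{i-1}\nabla\tilde L_i(x_{i,k})-\nabla f_{i-1}(x_{i-1,0}),s\rangle,$$ where $\tilde L_i=L_i-\phi_i$ is the smooth part of $L_i$. With $t>0$ fixed, $h_{i,k}=\frac1t\|x_{i,k}-\operatorname{Prox}_{t\phi_i}(x_{i,k}-t\nabla\tilde L_i(x_{i,k}))\|_i$, where $\operatorname{Prox}_{t\phi}(y)=\arg\min_x\{\phi(x)+\frac1{2t}\|x-y\|^2\}$; in particular, $h_{i-1,0}$ uses $\nabla\tilde L_{i-1}(x_{i-1,0})=R_i^{i-1}\nabla\tilde L_i(x_{i,k})$. Algorithm RMNTR at level $i$, called with upper radius $\Delta_{i+1}$ (the radius $\Delta_{i+1,q}$ of the calling iteration; $\Delta_{r+1}=\infty$). Parameters: $0<\eta_1<\eta_2<1$, $0<\gamma_1\le\gamma_2<1\le\gamma_3$, $\kappa_{\rm stop}\in(0,1)$, $\Delta_i^s>0$, tolerances $\epsilon_i^h,\epsilon_i^\Delta\in(0,1)$ (except that here $\epsilon_r^h=0$). Start: $x_{i,0}\in\operatorname{dom}\phi_i$, $\Delta_{i,0}=\min\{\Delta_i^s,\Delta_{i+1}\}$, $k=0$.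 Step 1: if $i=0$, or if not both $h_{i-1,0}\ge\kappa_{\rm stop}h_{i,k}$ and $h_{i-1,0}\ge\epsilon_{i-1}^h$ hold (with $x_{i-1,0}=R_i^{i-1}x_{i,k}$), do Step 3; else Step 2. Step 2 (recursive): call the algorithm at level $i-1$ on $L_{i-1}$ from $x_{i-1,0}$ with upper radius $\Delta_{i,k}$; with its output $x_{i-1,*}$ put $s_{i,k}=P_{i-1}^i(x_{i-1,*}-x_{i-1,0})$ and $m_{i,k}(x_{i,k}+P_{i-1}^is_{i-1})=L_{i-1}(x_{i-1,0}+s_{i-1})$. Step 3 (Taylor): with $m_{i,k}(x_{i,k}+s)=\tilde L_i(x_{i,k})+\langle\nabla\tilde L_i(x_{i,k}),s\rangle+\frac12\langle B_{i,k}s,s\rangle+\phi_i(x_{i,k}+s)$, $B_{i,k}=B_i(x_{i,k})$, find $s_{i,k}$ with $\|s_{i,k}\|_i\le\Delta_{i,k}$ and $m_{i,k}(x_{i,k})-m_{i,k}(x_{i,k}+s_{i,k})\ge\kappa_{\rm fcd}h_{i,k}\min\{h_{i,k}/(1+\|B_{i,k}\|_i),\Delta_{i,k}\}$, where $\kappa_{\rm fcd}>0$ is a fixed constant. Step 4: $\rho_{i,k}=\frac{L_i(x_{i,k})-L_i(x_{i,k}+s_{i,k})}{m_{i,k}(x_{i,k})-m_{i,k}(x_{i,k}+s_{i,k})}$; $x_{i,k+1}=x_{i,k}+s_{i,k}$ if $\rho_{i,k}\ge\eta_1$, else $x_{i,k+1}=x_{i,k}$. Step 5: if $h_{i,k}\le\epsilon_i^h$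 or $\|x_{i,k+1}-x_{i,0}\|_i>(1-\epsilon_i^\Delta)\Delta_{i+1}$, return $x_{i,*}=x_{i,k+1}$. Step 6: choose $\Delta_{i,k}^+\in[\Delta_{i,k},\gamma_3\Delta_{i,k}]$ if $\rho_{i,k}\ge\eta_2$; $\in[\gamma_2\Delta_{i,k},\Delta_{i,k}]$ if $\rho_{i,k}\in[\eta_1,\eta_2)$; $\in[\gamma_1\Delta_{i,k},\gamma_2\Delta_{i,k}]$ if $\rho_{i,k}<\eta_1$. Set $\Delta_{i,k+1}=\min\{\Delta_{i,k}^+,\Delta_{i+1}-\|x_{i,k+1}-x_{i,0}\|_i\}$, increase $k$ by 1, go to Step 1. *)

(* Defs.v *)
From HB Require Import structures.
From mathcomp Require Import all_boot all_order all_algebra.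
From mathcomp Require Import all_classical all_reals all_analysis.

Set Implicit Arguments.
Unset Strict Implicit.
Unset Printing Implicit Defensive.

Import Order.TTheory GRing.Theory Num.Theory.
Import numFieldNormedType.Exports.

Local Open Scope classical_set_scope.
Local Open Scope ring_scope.

(* Vectors of R^n are columns 'cV[R]_n.  Mathcomp-analysis equips them with the
   sup norm, which gives the right topology and Frechet differentiability but
   not the right norm; all quantitative norms below are Euclidean or M_i-norms. *)

Definition dotv {R : realType} {n} (u v : 'cV[R]_n) : R := (u^T *m v) 0 0.

Definition wnorm {R : realType} {n} (M : 'M[R]_n) (s : 'cV[R]_n) : R :=
  Num.sqrt (dotv s (M *m s)).

Definition enorm {R : realType} {n} (s : 'cV[R]_n) : R := wnorm 1%:M s.

Definition opnorm {R : realType} {n} (M A : 'M[R]_n) : R :=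
  sup [set wnorm M (A *m v) | v in [set v : 'cV[R]_n | wnorm M v <= 1]].

Definition grad {R : realType} {n} (f : 'cV[R]_n -> R) (x : 'cV[R]_n) : 'cV[R]_n :=
  \col_j 'D_(delta_mx j 0) f x.

Definition hess {R : realType} {n} (f : 'cV[R]_n -> R) (x : 'cV[R]_n) : 'M[R]_n :=
  \matrix_(i, j) ('D_(delta_mx j 0) (grad f) x) i 0.

Definition edom {R : realType} {n} (phi : 'cV[R]_n -> \bar R) : set 'cV[R]_n :=
  [set x | (phi x < +oo)%E].

Definition proper_fun {R : realType} {n} (phi : 'cV[R]_n -> \bar R) : Prop :=
  (forall x, phi x != -oo%E) /\ edom phi !=set0.

Definition closed_fun {R : realType} {n} (phi : 'cV[R]_n -> \bar R) : Prop :=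
  closed [set p : 'cV[R]_n * R | (phi p.1 <= p.2%:E)%E].

Definition convex_fun {R : realType} {n} (phi : 'cV[R]_n -> \bar R) : Prop :=
  forall (x y : 'cV[R]_n) (l : R), 0 < l < 1 ->
    (phi (l *: x + (1 - l) *: y)%R <= l%:E * phi x + (1 - l)%:E * phi y)%E.

(* For phi proper, closed and convex the minimizer exists and is unique, so the
   default value of xget is irrelevant. *)
Definition prox {R : realType} {n} (t : R) (phi : 'cV[R]_n -> \bar R)
    (y : 'cV[R]_n) : 'cV[R]_n :=
  xget 0 [set p | forall x, (phi p + ((2 * t)^-1 * enorm (p - y) ^+ 2)%:E
                          <= phi x + ((2 * t)^-1 * enorm (x - y) ^+ 2)%:E)%E].

(* y |-> (y_1, ..., y_m, 0, ..., 0) *)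
Definition pad {R : realType} {m n} (y : 'cV[R]_m) : 'cV[R]_n :=
  \col_j (if insub (j : nat) is Some k then y k 0 else 0).

(* Only the levels 0, ..., nlev are meaningful; restr i is R_{i+1}^i. *)
Record hierarchy (R : realType) := Hierarchy {
  nlev : nat;
  ldim : nat -> nat;
  restr : forall i, 'M[R]_(ldim i, ldim i.+1);
  lf : forall i, 'cV[R]_(ldim i) -> R;
  lB : forall i, 'cV[R]_(ldim i) -> 'M[R]_(ldim i);
  top_phi : 'cV[R]_(ldim nlev) -> \bar R }.

Arguments restr {R} H i : rename.
Arguments lf {R} H {i} x : rename.
Arguments lB {R} H {i} x : rename.
Arguments top_phi {R} H x : rename.

Record parameters (R : realType) := MkParams {
  eta1 : R; eta2 : R;
  gamma1 : R; gamma2 : R; gamma3 : R;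
  kstop : R; kfcd : R; tprox : R;
  Dstart : nat -> R;
  epsh : nat -> R;
  epsD : nat -> R }.

Definition prol {R : realType} (H : hierarchy R) i : 'M[R]_(ldim H i.+1, ldim H i) :=
  (restr H i)^T.

(* P_{i+d-1}^{i+d} ... P_i^{i+1} *)
Fixpoint prol_up {R : realType} (H : hierarchy R) i d : 'M[R]_(ldim H (d + i), ldim H i) :=
  match d with
  | 0 => 1%:M
  | e.+1 => prol H (e + i) *m prol_up H i e
  end.

Definition levelM {R : realType} (H : hierarchy R) i : 'M[R]_(ldim H i) :=
  (prol_up H i (nlev H - i))^T *m prol_up H i (nlev H - i).

Definition lnorm {R : realType} (H : hierarchy R) i (s : 'cV[R]_(ldim H i)) : R :=
  wnorm (levelM H i) s.

Definition coarse_phi {R : realType} (H : hierarchy R) i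
    (phi : 'cV[R]_(ldim H i.+1) -> \bar R) (x : 'cV[R]_(ldim H i.+1)) :
    'cV[R]_(ldim H i) -> \bar R :=
  fun y => phi (x + prol H i *m (y - restr H i *m x)).

(* phi_i depends, for i < r, on the points from which the levels i, ..., r-1
   are called; these are all the functions phi_i that may occur. *)
Inductive level_phi {R : realType} (H : hierarchy R) :
    forall i, ('cV[R]_(ldim H i) -> \bar R) -> Prop :=
| level_phi_top : level_phi (top_phi H)
| level_phi_call i (phi : 'cV[R]_(ldim H i.+1) -> \bar R) x :
    level_phi phi -> edom phi x -> level_phi (coarse_phi phi x).

Definition hierarchy_ok {R : realType} (H : hierarchy R) : Prop :=
  forall i, (i < nlev H)%N ->
    [/\ (ldim H i <= ldim H i.+1)%N,
        \rank (restr H i) = ldim H i,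
        restr H i *m (restr H i)^T = 1%:M
      & forall y : 'cV[R]_(ldim H i), lf H y = lf H (pad y : 'cV[R]_(ldim H i.+1))].

(* The assumptions on F_i = f_i + phi_i.  The Hessian bound is required
   on the open set where f_i is assumed to be smooth. *)
Definition level_ok {R : realType} (H : hierarchy R) (kappaH : R) i
    (phi : 'cV[R]_(ldim H i) -> \bar R) : Prop :=
  [/\ [/\ proper_fun phi, closed_fun phi & convex_fun phi],
      exists U : set 'cV[R]_(ldim H i),
        [/\ open U, edom phi `<=` U,
            forall x, U x -> differentiable (lf H (i := i)) x,
            exists K : R, forall x y, U x -> U y ->
              enorm (grad (lf H (i := i)) x - grad (lf H (i := i)) y)
                <= K * enorm (x - y)
          & forall x, U x ->
              [/\ differentiable (grad (lf H (i := i))) x,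
                  (lB H x)^T = lB H x
                & 1 + Num.max (opnorm 1%:M (hess (lf H (i := i)) x))
                              (opnorm 1%:M (lB H x)) <= kappaH]]
    & exists c : R, forall x, edom phi x -> (c%:E <= (lf H x)%:E + phi x)%E].

Definition parameters_ok {R : realType} (r : nat) (A : parameters R) : Prop :=
  [/\ [/\ 0 < eta1 A, eta1 A < eta2 A & eta2 A < 1],
      [/\ 0 < gamma1 A, gamma1 A <= gamma2 A, gamma2 A < 1 & 1 <= gamma3 A],
      [/\ 0 < kstop A < 1, 0 < kfcd A & 0 < tprox A],
      forall i, (i <= r)%N -> 0 < Dstart A i /\ 0 < epsD A i < 1
    & forall i, (i < r)%N -> 0 < epsh A i < 1].

(* The objective L_i = smooth + phi handled by one call at level i. *)
Record problem {R : realType} (H : hierarchy R) i := Problem {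
  smooth : 'cV[R]_(ldim H i) -> R;
  nonsmooth : 'cV[R]_(ldim H i) -> \bar R }.

Definition objective {R : realType} (H : hierarchy R) i (pb : problem H i)
    (x : 'cV[R]_(ldim H i)) : \bar R :=
  ((smooth pb x)%:E + nonsmooth pb x)%E.

Definition top_problem {R : realType} (H : hierarchy R) : problem H (nlev H) :=
  Problem (lf H (i := nlev H)) (top_phi H).

Definition coarse_problem {R : realType} (H : hierarchy R) i (pb : problem H i.+1)
    (x : 'cV[R]_(ldim H i.+1)) : problem H i :=
  let y0 := restr H i *m x in
  Problem
    (fun y => lf H y
       + dotv (restr H i *m grad (smooth pb) x - grad (lf H (i := i)) y0) (y - y0))
    (coarse_phi (nonsmooth pb) x).

Definition hmeas {R : realType} (H : hierarchy R) (A : parameters R) i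
    (pb : problem H i) (x : 'cV[R]_(ldim H i)) : R :=
  (tprox A)^-1 *
  lnorm (x - prox (tprox A) (nonsmooth pb) (x - tprox A *: grad (smooth pb) x)).

(* The sequences x_{i,k}, Delta_{i,k}, s_{i,k}, m_{i,k} of one call at level i. *)
Record trajectory {R : realType} (H : hierarchy R) i := Trajectory {
  pt : nat -> 'cV[R]_(ldim H i);
  rad : nat -> R;
  stp : nat -> 'cV[R]_(ldim H i);
  mdl : nat -> 'cV[R]_(ldim H i) -> \bar R }.

(* Possible model m and step s at a point x with radius Delta. *)
Definition step_rel {R : realType} (H : hierarchy R) i : Type :=
  problem H i -> 'cV[R]_(ldim H i) -> R ->
  ('cV[R]_(ldim H i) -> \bar R) -> 'cV[R]_(ldim H i) -> Prop.

Definition taylor_step {R : realType} (H : hierarchy R) (A : parameters R) i :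
    step_rel H i :=
  fun pb x Delta m s =>
  let h := hmeas A pb x in
  [/\ forall v, m (x + v) =
        ((smooth pb x + dotv (grad (smooth pb) x) v + 2^-1 * dotv (lB H x *m v) v)%:E
         + nonsmooth pb (x + v)%R)%E,
      lnorm s <= Delta
    & ((kfcd A * h * Num.min (h / (1 + opnorm (levelM H i) (lB H x))) Delta)%:E
         <= m x - m (x + s)%R)%E].

(* The objective and the model are finite at the points where ratio is used.
   If the predicted decrease is zero, ratio is 0 (as x / 0 = 0), so the step
   is rejected and the radius reduced. *)
Definition ratio {R : realType} (H : hierarchy R) i (pb : problem H i)
    (tr : trajectory H i) k : R :=
  let x := pt tr k in let y := x + stp tr k in
  fine (objective pb x - objective pb y)%E / fine (mdl tr k x - mdl tr k y)%E.

Definition iteration {R : realType} (H : hierarchy R) (A : parameters R) i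
    (step : step_rel H i) (pb : problem H i) (tr : trajectory H i) k : Prop :=
  step pb (pt tr k) (rad tr k) (mdl tr k) (stp tr k) /\
  pt tr k.+1 =
    if eta1 A <= ratio pb tr k then pt tr k + stp tr k else pt tr k.

(* Dup is the upper radius Delta_{i+1}, equal to +oo at the top level. *)
Definition stops {R : realType} (H : hierarchy R) (A : parameters R) i
    (pb : problem H i) (Dup : \bar R) (tr : trajectory H i) k : Prop :=
  hmeas A pb (pt tr k) <= epsh A i \/
  ((1 - epsD A i)%:E * Dup < (lnorm (pt tr k.+1 - pt tr 0%N))%:E)%E.

Definition radius_update {R : realType} (H : hierarchy R) (A : parameters R) i
    (pb : problem H i) (Dup : \bar R) (tr : trajectory H i) k : Prop :=
  let D := rad tr k in let rho := ratio pb tr k in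
  exists Dp : R,
    [/\ eta2 A <= rho -> D <= Dp <= gamma3 A * D,
        eta1 A <= rho < eta2 A -> gamma2 A * D <= Dp <= D,
        rho < eta1 A -> gamma1 A * D <= Dp <= gamma2 A * D
      & (rad tr k.+1)%:E =
          Order.min Dp%:E (Dup - (lnorm (pt tr k.+1 - pt tr 0%N))%:E)%E].

(* The call has been started and has completed iterations 0, ..., N-1
   without returning. *)
Definition reaches {R : realType} (H : hierarchy R) (A : parameters R) i
    (step : step_rel H i) (pb : problem H i) (x0 : 'cV[R]_(ldim H i)) (Dup : \bar R)
    (tr : trajectory H i) (N : nat) : Prop :=
  [/\ pt tr 0%N = x0,
      (rad tr 0%N)%:E = Order.min (Dstart A i)%:E Dup
    & forall k, (k < N)%N ->
        [/\ iteration A step pb tr k,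
            ~ stops A pb Dup tr k
          & radius_update A pb Dup tr k]].

Definition returns_at {R : realType} (H : hierarchy R) (A : parameters R) i
    (step : step_rel H i) (pb : problem H i) (x0 : 'cV[R]_(ldim H i)) (Dup : \bar R)
    (tr : trajectory H i) (N : nat) : Prop :=
  [/\ reaches A step pb x0 Dup tr N,
      iteration A step pb tr N
    & stops A pb Dup tr N].

Definition recurses {R : realType} (H : hierarchy R) (A : parameters R) i
    (pb : problem H i.+1) (x : 'cV[R]_(ldim H i.+1)) : Prop :=
  let h0 := hmeas A (coarse_problem pb x) (restr H i *m x) in
  kstop A * hmeas A pb x <= h0 /\ epsh A i <= h0.

Fixpoint rmntr_step {R : realType} (H : hierarchy R) (A : parameters R) i :
    step_rel H i :=
  match i return step_rel H i with
  | 0 => taylor_step A (i := 0)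
  | j.+1 => fun pb x Delta m s =>
      let pb0 := coarse_problem pb x in
      let y0 := restr H j *m x in
      (recurses A pb x /\
       exists (tr : trajectory H j) (N : nat),
         [/\ returns_at A (@rmntr_step R H A j) pb0 y0 Delta%:E tr N,
             s = prol H j *m (pt tr N.+1 - y0)
           & forall v, m (x + prol H j *m v) = objective pb0 (y0 + v)])
      \/ (~ recurses A pb x /\ taylor_step A pb x Delta m s)
  end.

(* The iteration is recursive but its call never returns: that call iterates
   forever or is itself blocked in a deeper call. *)
Fixpoint blocked {R : realType} (H : hierarchy R) (A : parameters R) i :
    problem H i -> 'cV[R]_(ldim H i) -> R -> Prop :=
  match i return problem H i -> 'cV[R]_(ldim H i) -> R -> Prop with
  | 0 => fun _ _ _ => False
  | j.+1 => fun pb x Delta =>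
      let pb0 := coarse_problem pb x in
      let y0 := restr H j *m x in
      recurses A pb x /\
      exists tr : trajectory H j,
        (forall N, reaches A (@rmntr_step R H A j) pb0 y0 Delta%:E tr N) \/
        (exists2 N, reaches A (@rmntr_step R H A j) pb0 y0 Delta%:E tr N &
                    blocked A pb0 (pt tr N) (rad tr N))
  end.

(* A complete run at the uppermost level.  lastk = Some N: no iteration follows
   iteration N, because the algorithm terminates there or because the recursive
   call made there never returns (termination of recursive calls is not assumed). *)
Definition rmntr_run {R : realType} (H : hierarchy R) (A : parameters R)
    (x0 : 'cV[R]_(ldim H (nlev H))) (tr : trajectory H (nlev H))
    (lastk : option nat) : Prop :=
  let pb := top_problem H in
  let step := @rmntr_step R H A (nlev H) in
  match lastk with
  | None => forall N, reaches A step pb x0 +oo%E tr N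
  | Some N =>
      returns_at A step pb x0 +oo%E tr N \/
      (reaches A step pb x0 +oo%E tr N /\ blocked A pb (pt tr N) (rad tr N))
  end.

(* h_{r,k}, constant from the last iteration on *)
Definition hseq {R : realType} (H : hierarchy R) (A : parameters R)
    (tr : trajectory H (nlev H)) (lastk : option nat) (k : nat) : R :=
  hmeas A (top_problem H) (pt tr (if lastk is Some N then minn k N else k)).

(* Main.v *)
(* Restrictions are isometric on the coarse spaces, so every level norm is
   Euclidean.  By induction on the level there are constants a, b, c > 0, uniform
   over all calls made at that level, such that a step from x within radius D has
   predicted decrease at least c h min(a h, b, D), unless that decrease is zero,
   and is very successful as soon as D <= min(a h, b).  For a recursive step both
   facts come from the first successful iteration of the call below, made at its
   starting point, where h is at least kappa_stop times the current h; first-order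
   coherence and the Hessian bound make the model error O(D^2).  Hence in a call
   that iterates forever with h bounded away from 0, the radius stays bounded
   away from 0, successes keep occurring, and each decreases the objective by a
   fixed amount.  This is impossible when the objective is bounded below along
   the iterates: lower-level calls therefore return, and at the top level h
   cannot stay away from 0. *)

Require Import Defs.
From mathcomp Require Import all_boot all_order all_algebra.
From mathcomp Require Import all_classical all_reals all_analysis.
From mathcomp Require Import ring lra.
Set Implicit Arguments.
Unset Strict Implicit.
Unset Printing Implicit Defensive.
Import Order.TTheory GRing.Theory Num.Theory.
Import numFieldNormedType.Exports.
Local Open Scope classical_set_scope.
Local Open Scope ring_scope.

(* [fraction.ratio] and [sesquilinear.rad] hide the names of Defs. *)
Local Notation ratio := Defs.ratio.
Local Notation rad := Defs.rad.

(** * Euclidean norm and Taylor estimates *)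

Section Euclidean.
Context {R : realType}.
Implicit Types n : nat.

Lemma dotvE n (u v : 'cV[R]_n) : dotv u v = \sum_i u i 0 * v i 0.
Proof. by rewrite /dotv mxE; apply: eq_bigr => i _; rewrite mxE. Qed.

Lemma dotvC n (u v : 'cV[R]_n) : dotv u v = dotv v u.
Proof. by rewrite !dotvE; apply: eq_bigr => i _; rewrite mulrC. Qed.

Lemma dotvDl n (u v w : 'cV[R]_n) : dotv (u + v) w = dotv u w + dotv v w.
Proof. by rewrite /dotv linearD /= mulmxDl mxE. Qed.

Lemma dotvDr n (u v w : 'cV[R]_n) : dotv w (u + v) = dotv w u + dotv w v.
Proof. by rewrite !(dotvC w) dotvDl. Qed.

Lemma dotvZl n a (u v : 'cV[R]_n) : dotv (a *: u) v = a * dotv u v.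
Proof. by rewrite /dotv linearZ /= -scalemxAl mxE. Qed.

Lemma dotvZr n a (u v : 'cV[R]_n) : dotv u (a *: v) = a * dotv u v.
Proof. by rewrite dotvC dotvZl dotvC. Qed.

Lemma dotvNl n (u v : 'cV[R]_n) : dotv (- u) v = - dotv u v.
Proof. by rewrite -scaleN1r dotvZl mulN1r. Qed.

Lemma dotvBl n (u v w : 'cV[R]_n) : dotv (u - v) w = dotv u w - dotv v w.
Proof. by rewrite dotvDl dotvNl. Qed.

Lemma dotv0 n (u : 'cV[R]_n) : dotv u 0 = 0.
Proof. by rewrite -(scale0r 0) dotvZr mul0r. Qed.

Lemma dot0v n (u : 'cV[R]_n) : dotv 0 u = 0.
Proof. by rewrite dotvC dotv0. Qed.

Lemma dotv_mull m n (P : 'M[R]_(m, n)) (u : 'cV[R]_m) v :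
  dotv u (P *m v) = dotv (P^T *m u) v.
Proof. by rewrite /dotv trmx_mul trmxK mulmxA. Qed.

Lemma dotvv_ge0 n (u : 'cV[R]_n) : 0 <= dotv u u.
Proof. by rewrite dotvE; apply: sumr_ge0 => i _; rewrite -expr2 sqr_ge0. Qed.

Lemma dotvv_eq0 n (u : 'cV[R]_n) : dotv u u = 0 -> u = 0.
Proof.
rewrite dotvE => /eqP; rewrite psumr_eq0 => [/allP u0|i _]; last first.
  by rewrite -expr2 sqr_ge0.
apply/matrixP => i j; rewrite ord1 mxE.
by have /eqP/eqP := u0 i (mem_index_enum i); rewrite mulf_eq0 orbb => /eqP.
Qed.

Lemma enormE n (u : 'cV[R]_n) : enorm u = Num.sqrt (dotv u u).
Proof. by rewrite /enorm /wnorm mul1mx. Qed.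

Lemma enorm_ge0 n (u : 'cV[R]_n) : 0 <= enorm u.
Proof. by rewrite enormE sqrtr_ge0. Qed.

Lemma sqr_enorm n (u : 'cV[R]_n) : enorm u ^+ 2 = dotv u u.
Proof. by rewrite enormE sqr_sqrtr ?dotvv_ge0. Qed.

Lemma enorm0 n : enorm (0 : 'cV[R]_n) = 0.
Proof. by rewrite enormE dotv0 sqrtr0. Qed.

Lemma enorm0_eq0 n (u : 'cV[R]_n) : enorm u = 0 -> u = 0.
Proof. by move=> u0; apply: dotvv_eq0; rewrite -sqr_enorm u0 expr0n. Qed.

Lemma enormZ n a (u : 'cV[R]_n) : enorm (a *: u) = `|a| * enorm u.
Proof.
by rewrite !enormE dotvZl dotvZr mulrA -expr2 sqrtrM ?sqr_ge0// sqrtr_sqr.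
Qed.

(** The vector [dotv v v *: u - dotv u v *: v] has nonnegative squared norm, equal to [dotv v v]
    times the gap between the squared sides. *)
Lemma cauchy_schwarz n (u v : 'cV[R]_n) : `|dotv u v| <= enorm u * enorm v.
Proof.
rewrite -ler_sqr ?nnegrE ?mulr_ge0 ?enorm_ge0 ?normr_ge0//.
rewrite exprMn !sqr_enorm real_normK ?num_real//.
have [v0|v_neq0] := eqVneq (dotv v v) 0.
  by rewrite (dotvv_eq0 v0) !dotv0 expr0n mulr0.
have v_gt0 : 0 < dotv v v by rewrite lt_def v_neq0 dotvv_ge0.
have := dotvv_ge0 (dotv v v *: u - dotv u v *: v).
rewrite dotvBl !dotvDr -!scaleNr !(dotvZl, dotvZr) (dotvC v u) => h.
have {}h : 0 <= dotv v v * (dotv u u * dotv v v - dotv u v ^+ 2).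
  by apply: le_trans h _; rewrite le_eqVlt; apply/orP; left; apply/eqP; ring.
by move: h; rewrite pmulr_rge0// subr_ge0.
Qed.

Lemma enormD n (u v : 'cV[R]_n) : enorm (u + v) <= enorm u + enorm v.
Proof.
rewrite -ler_sqr ?nnegrE ?addr_ge0 ?enorm_ge0//.
rewrite sqrrD !sqr_enorm dotvDl !dotvDr (dotvC v u).
have := le_trans (ler_norm _) (cauchy_schwarz u v); lra.
Qed.

Lemma enorm_isom m n (P : 'M[R]_(m, n)) (v : 'cV[R]_n) :
  P^T *m P = 1%:M -> enorm (P *m v) = enorm v.
Proof. by move=> PP; rewrite !enormE dotv_mull mulmxA PP mul1mx. Qed.

Definition frobenius n (A : 'M[R]_n) : R :=
  Num.sqrt (\sum_i dotv (row i A)^T (row i A)^T).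

Lemma enorm_mulmx_frobenius n (A : 'M[R]_n) v :
  enorm (A *m v) <= frobenius A * enorm v.
Proof.
rewrite /frobenius !enormE -sqrtrM; last by apply: sumr_ge0 => i _; exact: dotvv_ge0.
apply: ler_wsqrtr; rewrite mulr_suml (dotvE (A *m v)); apply: ler_sum => i _.
have -> : (A *m v) i 0 = dotv (row i A)^T v.
  by rewrite dotvE mxE; apply: eq_bigr => j _; rewrite !mxE.
rewrite -!sqr_enorm -exprMn -expr2 -(real_normK (num_real (dotv _ _))).
by rewrite ler_sqr ?nnegrE ?mulr_ge0 ?enorm_ge0 ?normr_ge0// cauchy_schwarz.
Qed.

(** The [sup] in [opnorm] is informative only for a nonempty set bounded above; the Frobenius norm
    supplies the bound. *)
Lemma opnorm_has_sup n (A : 'M[R]_n) :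
  has_sup [set enorm (A *m v) | v in [set v : 'cV[R]_n | enorm v <= 1]].
Proof.
split; first by exists (enorm (A *m 0)), 0 => //=; rewrite enorm0 ler01.
exists (frobenius A) => _ [v /= v1 <-].
apply: le_trans (enorm_mulmx_frobenius _ _) _.
by rewrite ler_piMr ?sqrtr_ge0.
Qed.

Lemma opnorm_ge0 n (A : 'M[R]_n) : 0 <= opnorm 1%:M A.
Proof.
apply: (@sup_upper_bound _ _ (opnorm_has_sup A)).
by exists 0 => /=; rewrite ?mulmx0 enorm0 ?ler01.
Qed.

Lemma enorm_mulmx n (A : 'M[R]_n) v :
  enorm (A *m v) <= opnorm 1%:M A * enorm v.
Proof.
have [/enorm0_eq0 ->|v_neq0] := eqVneq (enorm v) 0.
  by rewrite mulmx0 enorm0 mulr0.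
have v_gt0 : 0 < enorm v by rewrite lt_def v_neq0 enorm_ge0.
rewrite -ler_pdivrMr//.
apply: (@sup_upper_bound _ _ (opnorm_has_sup A)).
exists ((enorm v)^-1 *: v) => /=.
  by rewrite enormZ ger0_norm ?invr_ge0 ?enorm_ge0// mulVf.
rewrite -scalemxAr -/(enorm _) enormZ ger0_norm ?invr_ge0 ?enorm_ge0//.
by rewrite mulrC.
Qed.

Lemma dotv_mulmx n (A : 'M[R]_n) v :
  `|dotv (A *m v) v| <= opnorm 1%:M A * enorm v ^+ 2.
Proof.
apply: le_trans (cauchy_schwarz _ _) _.
by rewrite expr2 mulrA ler_wpM2r ?enorm_ge0 ?enorm_mulmx.
Qed.

End Euclidean.

(** * Second-order Taylor bound along a segment *)

Section Taylor.
Context {R : realType}.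
Implicit Types n : nat.

Lemma is_derive_line n (f : 'cV[R]_n -> R) x s t :
  derivable f (x + t *: s) s ->
  is_derive t 1 (fun u : R => f (x + u *: s)) ('D_s f (x + t *: s)).
Proof.
have quotE : (fun h : R => h^-1 *: (((fun u : R => f (x + u *: s)) \o shift t) (h *: 1)
      - f (x + t *: s))) =
    (fun h : R => h^-1 *: ((f \o shift (x + t *: s)) (h *: s) - f (x + t *: s))).
  apply/funext => h /=; rewrite [h *: 1]mulr1; congr (_ *: (f _ - _)).
  by rewrite scalerDl addrCA.
by move=> fs; split; rewrite /derivable /derive quotE.
Qed.

Lemma cV_sum_delta n (s : 'cV[R]_n) : s = \sum_j s j 0 *: delta_mx j 0.
Proof.
rewrite [LHS]matrix_sum_delta; apply: eq_bigr => j _.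
by rewrite big_ord1.
Qed.

Lemma derive_grad n (f : 'cV[R]_n -> R) x s :
  differentiable f x -> 'D_s f x = dotv (grad f x) s.
Proof.
move=> df; rewrite deriveE// {1}(cV_sum_delta s) linear_sum dotvE.
apply: eq_bigr => j _; by rewrite linearZ /= mxE -deriveE// mulrC.
Qed.

Lemma derive_hess n (f : 'cV[R]_n -> R) x s :
  differentiable (grad f) x -> 'D_s (grad f) x = hess f x *m s.
Proof.
move=> df; rewrite deriveE// {1}(cV_sum_delta s) linear_sum /=.
apply/matrixP => i k; rewrite ord1 summxE mxE; apply: eq_bigr => j _.
by rewrite linearZ /= !mxE -deriveE// mulrC.
Qed.

Lemma is_derive_grad_line n (f : 'cV[R]_n -> R) x s t :
  differentiable (grad f) (x + t *: s) ->
  is_derive t 1 (fun u : R => dotv (grad f (x + u *: s)) s)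
    (dotv (hess f (x + t *: s) *m s) s).
Proof.
move=> df.
have dsf : derivable (grad f) (x + t *: s) s by exact: diff_derivable.
rewrite -derive_hess// derive_mx// dotvE.
have -> : (fun u : R => dotv (grad f (x + u *: s)) s) =
    \sum_i (s i 0 \*: (fun u : R => grad f (x + u *: s) i 0)).
  apply/funext => u; rewrite dotvE fct_sumE; apply: eq_bigr => i _.
  by rewrite mulrC.
under [X in is_derive _ _ _ X]eq_bigr do rewrite mxE mulrC.
apply: is_derive_sum => i; apply: is_deriveZ.
apply: (@is_derive_line _ (fun y => grad f y i 0)).
exact: (derivable_mxP _ _ _).1 dsf i 0.
Qed.

(** The mean value theorem is applied twice: to [f] along the segment, then to the derivative so
    obtained. The factor 1/2 of the sharp remainder is lost, which only changes constants. *)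
Lemma taylor2 n (f : 'cV[R]_n -> R) (kappa : R) x s :
  (forall t : R, 0 <= t <= 1 ->
    [/\ differentiable f (x + t *: s), differentiable (grad f) (x + t *: s)
      & opnorm 1%:M (hess f (x + t *: s)) <= kappa]) ->
  `|f (x + s) - f x - dotv (grad f x) s| <= kappa * enorm s ^+ 2.
Proof.
move=> hf.
have itv01 (c t : R) : c \in `[0, 1] -> t \in `[0, c] -> 0 <= t <= 1.
  rewrite !in_itv /= => /andP[c0 c1] /andP[t0 tc]; rewrite t0 /=; lra.
have df1 (c : R) : c \in `[0, 1] -> is_derive c 1 (fun u : R => f (x + u *: s))
    (dotv (grad f (x + c *: s)) s).
  rewrite in_itv /= => /hf[dfc _ _]; rewrite -derive_grad//.
  by apply: is_derive_line; exact: diff_derivable.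
have df2 (c : R) : c \in `[0, 1] -> is_derive c 1
    (fun u : R => dotv (grad f (x + u *: s)) s) (dotv (hess f (x + c *: s) *m s) s).
  by rewrite in_itv /= => /hf[_ dgc _]; exact: is_derive_grad_line.
have MVT1 (g dg : R -> R) (c : R) : 0 <= c <= 1 ->
    (forall t : R, t \in `[0, 1] -> is_derive t 1 g (dg t)) ->
    exists2 t, t \in `[0, c] & g c - g 0 = dg t * c.
  move=> /andP[c0 c1] dgP.
  have sub (t : R) : t \in `[0, c] -> t \in `[0, 1].
    by move=> /itv01 h; rewrite in_itv /= h// in_itv /= c0.
  have der (t : R) : t \in `]0, c[%R -> is_derive t 1 g (dg t).
    by move=> tc; apply: dgP; apply: sub; exact: subset_itv_oo_cc tc.
  have cont : {within `[0, c], continuous g}.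
    by apply: derivable_within_continuous => t /sub/dgP[].
  have [t tc E] := MVT_segment c0 der cont.
  by exists t; rewrite // E subr0.
have [|c c01] := MVT1 _ _ 1 _ df1; first by rewrite ler01 lexx.
rewrite scale1r scale0r addr0 mulr1 => ->.
have c01' : 0 <= c <= 1 by move: c01; rewrite in_itv.
have [t tc] := MVT1 _ _ c c01' df2.
rewrite scale0r addr0 => ->.
have [_ _ ht] := hf t (itv01 c t c01 tc).
rewrite normrM; case/andP: c01' => c0 c1; rewrite (ger0_norm c0).
have := dotv_mulmx (hess f (x + t *: s)) s.
have := enorm_ge0 s; have := normr_ge0 (dotv (hess f (x + t *: s) *m s) s).
have := opnorm_ge0 (hess f (x + t *: s)).
set a := `|_|; set b := opnorm _ _ in ht *; set e := enorm s => b0 a0 e0 ab.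
apply: le_trans (_ : a <= _); first by rewrite ler_piMr.
by apply: le_trans ab _; rewrite ler_wpM2r// exprn_ge0.
Qed.

Lemma grad_add_linear n (f : 'cV[R]_n -> R) (g y0 x : 'cV[R]_n) :
  differentiable f x ->
  grad (fun y => f y + dotv g (y - y0)) x = grad f x + g.
Proof.
move=> df; apply/matrixP => j k; rewrite ord1 !mxE.
have dl v : is_derive x v (fun y => dotv g (y - y0)) (dotv g v).
  have E : (fun h : R => h^-1 *: (((fun y => dotv g (y - y0)) \o shift x) (h *: v)
      - dotv g (x - y0))) = (fun h : R => h^-1 * h * dotv g v).
    apply/funext => h /=; rewrite -(addrA (h *: v)) (dotvDr (h *: v)) dotvZr addrK.
    by rewrite [_ *: _]mulrA.
  (* The difference quotient is constant away from [h = 0]; the factor [h^-1 * h] is kept because it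
     vanishes at 0. *)
  have cv : (fun h : R => h^-1 * h * dotv g v) @ 0^' --> dotv g v.
    apply: cvg_near_cst; near=> h; rewrite mulVf ?mul1r//.
    by near: h; exact: nbhs_dnbhs_neq.
  split; first by rewrite /derivable E; apply/cvg_ex; exists (dotv g v).
  by rewrite /derive E; apply: cvg_lim.
have := @deriveD _ _ _ f (fun y => dotv g (y - y0)) x (delta_mx j 0).
rewrite /GRing.add /= => ->; last by [].
  rewrite derive_val dotvE (bigD1 j)//= mxE !eqxx mulr1 big1 ?addr0// => i ij.
  by rewrite mxE (negPf ij) mulr0.
exact: diff_derivable.
Unshelve. all: by end_near. Qed.

End Taylor.

(** * Objectives of the levels *)

Section Levels.
Context {R : realType} (H : hierarchy R).

Section LevelNorm.
Hypothesis hH : hierarchy_ok H.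

Lemma prol_isom i : (i < nlev H)%N -> (prol H i)^T *m prol H i = 1%:M.
Proof. by move=> /hH[_ _ RR _]; rewrite /prol trmxK. Qed.

(** The product collapses from the middle, since each prolongation is an isometry. *)
Lemma levelM1 i : (i <= nlev H)%N -> levelM H i = 1%:M.
Proof.
move=> ilen; rewrite /levelM.
have : (nlev H - i + i <= nlev H)%N by rewrite subnK.
elim: (nlev H - i)%N => [|d IH] /= le; first by rewrite trmx1 mul1mx.
rewrite trmx_mul -mulmxA (mulmxA (prol H _)^T) prol_isom//.
by rewrite mul1mx IH// ltnW.
Qed.

Lemma lnormE i (s : 'cV[R]_(ldim H i)) : (i <= nlev H)%N -> lnorm s = enorm s.
Proof. by move=> ilen; rewrite /lnorm levelM1. Qed.

End LevelNorm.

(* The shape of the objectives handed to the recursive calls: [f_i + phi_i]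
   plus a linear term. *)
Definition admissible i (pb : problem H i) : Prop :=
  level_phi (nonsmooth pb) /\
  exists g y0, smooth pb = (fun y => lf H y + dotv g (y - y0)).

Lemma admissible_top : admissible (top_problem H).
Proof.
split; first exact: level_phi_top.
by exists 0, 0; apply/funext => y; rewrite dot0v addr0.
Qed.

Lemma admissible_coarse i (pb : problem H i.+1) x :
  admissible pb -> edom (nonsmooth pb) x -> admissible (coarse_problem pb x).
Proof.
move=> [pbphi _] xD; split; first exact: level_phi_call.
by exists (restr H i *m grad (smooth pb) x - grad (lf H (i := i)) (restr H i *m x)),
  (restr H i *m x).
Qed.

Lemma coarse_phi_add i (pb : problem H i.+1) x v :
  nonsmooth (coarse_problem pb x) (restr H i *m x + v) =
  nonsmooth pb (x + prol H i *m v).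
Proof. by rewrite /= /coarse_phi (addrC (restr H i *m x)) addrK. Qed.

Lemma edom_coarse i (pb : problem H i.+1) x v :
  edom (nonsmooth (coarse_problem pb x)) (restr H i *m x + v) =
  edom (nonsmooth pb) (x + prol H i *m v).
Proof. by rewrite /edom /mkset coarse_phi_add. Qed.

Lemma edom_coarse0 i (pb : problem H i.+1) x :
  edom (nonsmooth (coarse_problem pb x)) (restr H i *m x) =
  edom (nonsmooth pb) x.
Proof. by rewrite -[_ *m x]addr0 edom_coarse mulmx0 addr0. Qed.

Definition objval i (pb : problem H i) x : R := fine (objective pb x).

Section Regularity.
Context (kappaH : R).
Hypothesis hF : forall (i : nat) (phi : 'cV[R]_(ldim H i) -> \bar R),
  level_phi phi -> level_ok kappaH phi.
Context (i : nat) (pb : problem H i).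
Hypothesis pb_adm : admissible pb.
Local Notation dom := (edom (nonsmooth pb)).

Lemma nonsmooth_fin x : dom x -> nonsmooth pb x \is a fin_num.
Proof.
move=> xD; have [[[phiNy _] _ _] _ _] := hF pb_adm.1.
by rewrite fin_numE phiNy lt_eqF.
Qed.

Lemma objective_fin x : dom x -> objective pb x \is a fin_num.
Proof. by move=> /nonsmooth_fin phix; rewrite fin_numD phix. Qed.

Lemma objvalE x : dom x -> objval pb x = smooth pb x + fine (nonsmooth pb x).
Proof. by move=> /nonsmooth_fin phix; rewrite /objval fineD. Qed.

Lemma edom_segment x s (t : R) :
  dom x -> dom (x + s) -> 0 <= t <= 1 -> dom (x + t *: s).
Proof.
move=> xD sD /andP[]; rewrite le_eqVlt => /predU1P[<-|t0].
  by rewrite scale0r addr0.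
rewrite le_eqVlt => /predU1P[->|t1]; first by rewrite scale1r.
have [[_ _ phi_conv] _ _] := hF pb_adm.1.
have -> : x + t *: s = t *: (x + s) + (1 - t) *: x.
  by rewrite scalerDr scalerBl scale1r addrAC addrCA subrr addr0.
apply: le_lt_trans (phi_conv _ _ _ _) _; first by rewrite t0.
by rewrite lte_add_pinfty// ltey_eq fin_numM// nonsmooth_fin.
Qed.

Lemma lf_differentiable x : dom x -> differentiable (lf H (i := i)) x.
Proof.
by move=> xD; have [_ [U [_ domU dU _ _]] _] := hF pb_adm.1; exact/dU/domU.
Qed.

(* The Lipschitz constant of the gradient in [level_ok] depends on phi, hence on
   the calling iterate; only the Hessian bound is uniform over the calls. *)
Lemma hess_bound x : dom x ->
  differentiable (grad (lf H (i := i))) x /\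
  opnorm 1%:M (hess (lf H (i := i)) x) <= kappaH.
Proof.
move=> xD; have [_ [U [_ domU _ _ /(_ x (domU x xD))[dg _ p]]] _] := hF pb_adm.1.
split=> //; move: p; set o1 := opnorm _ (hess _ _); set o2 := opnorm _ _ => p.
have : o1 <= Num.max o1 o2 by rewrite le_max lexx.
lra.
Qed.

Lemma lB_bound x : dom x -> 1 + opnorm 1%:M (lB H x) <= kappaH.
Proof.
move=> xD; have [_ [U [_ domU _ _ /(_ x (domU x xD))[_ _ p]]] _] := hF pb_adm.1.
by apply: le_trans p; rewrite lerD2l le_max lexx orbT.
Qed.

(** The linear term of an admissible problem cancels in the Taylor remainder, so the bound for [lf]
    holds with the same constant in every call. *)
Lemma smooth_taylor x s : dom x -> dom (x + s) ->
  `|smooth pb (x + s) - smooth pb x - dotv (grad (smooth pb) x) s| <=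
    kappaH * enorm s ^+ 2.
Proof.
move=> xD sD; have [_ [g [y0 ->]]] := pb_adm.
rewrite grad_add_linear; last exact: lf_differentiable.
have -> : lf H (x + s) + dotv g (x + s - y0) - (lf H x + dotv g (x - y0)) -
    dotv (grad (lf H (i := i)) x + g) s =
    lf H (x + s) - lf H x - dotv (grad (lf H (i := i)) x) s.
  by rewrite addrAC !dotvDr dotvDl; ring.
apply: taylor2 => t t01; have tD := edom_segment xD sD t01.
by have [? ?] := hess_bound tD; split => //; exact: lf_differentiable.
Qed.

(** The linear term may be unbounded below on the whole space; on a ball it is controlled by
    Cauchy-Schwarz. *)
Lemma objval_lower x0 (D : R) :
  exists l, forall x, dom x -> enorm (x - x0) <= D -> l <= objval pb x.
Proof.
have [_ [g [y0 smoothE]]] := pb_adm.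
have [_ _ [c hc]] := hF pb_adm.1.
exists (c + dotv g (x0 - y0) - enorm g * D) => x xD xx0.
rewrite objvalE// smoothE.
have := hc x xD; rewrite -(fineK (nonsmooth_fin xD)) -EFinD lee_fin.
have -> : x - y0 = (x - x0) + (x0 - y0) by rewrite addrA subrK.
rewrite (dotvDr (x - x0)).
have := le_trans (cauchy_schwarz g (x - x0)) (ler_wpM2l (enorm_ge0 g) xx0).
rewrite ler_norml => /andP[]; lra.
Qed.

End Regularity.

Lemma top_objval_lower (kappaH : R) :
  (forall (i : nat) (phi : 'cV[R]_(ldim H i) -> \bar R),
    level_phi phi -> level_ok kappaH phi) ->
  exists l, forall x, edom (top_phi H) x -> l <= objval (top_problem H) x.
Proof.
move=> hF; have [_ _ [c hc]] := hF _ _ (level_phi_top H).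
exists c => x xD; rewrite (objvalE hF admissible_top)//=.
have /fineK E := nonsmooth_fin hF admissible_top xD.
by have := hc x xD; rewrite -[X in (_ + X)%E]E -EFinD lee_fin.
Qed.

(** First-order coherence: the linear correction replaces the gradient of [lf] at the starting point
    by the restricted gradient of the calling level. *)
Lemma grad_coarse (kappaH : R) i (pb : problem H i.+1) x :
  (forall (i : nat) (phi : 'cV[R]_(ldim H i) -> \bar R),
    level_phi phi -> level_ok kappaH phi) ->
  admissible pb -> edom (nonsmooth pb) x ->
  grad (smooth (coarse_problem pb x)) (restr H i *m x) =
    restr H i *m grad (smooth pb) x.
Proof.
move=> hF pb_adm xD; rewrite grad_add_linear; first by rewrite addrC subrK.
apply: (lf_differentiable hF (admissible_coarse pb_adm xD)).
by rewrite edom_coarse0.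
Qed.

Lemma hmeas_ge0 (A : parameters R) i (pb : problem H i) x :
  0 < tprox A -> 0 <= hmeas A pb x.
Proof. by move=> t0; rewrite mulr_ge0 ?sqrtr_ge0// invr_ge0 ltW. Qed.

End Levels.

(** The form of the guaranteed decrease common to all levels: [b] absorbs the starting radii of
    lower calls, [a] the Hessian bound and the model error. *)
Definition decrease {R : realDomainType} (c a b h D : R) : R :=
  c * h * Num.min (a * h) (Num.min b D).

Section Decrease.
Context {R : realDomainType}.
Implicit Types c a b h D : R.

Lemma decrease_gt0 c a b h D : 0 < c -> 0 < a -> 0 < b -> 0 < h -> 0 < D ->
  0 < decrease c a b h D.
Proof. by move=> c0 a0 b0 h0 D0; rewrite !mulr_gt0// !lt_min mulr_gt0// b0. Qed.

Lemma decrease_ge0 c a b h D : 0 < c -> 0 < a -> 0 < b -> 0 <= h -> 0 < D ->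
  0 <= decrease c a b h D.
Proof.
move=> c0 a0 b0; rewrite le_eqVlt => /predU1P[<-|h0] D0.
  by rewrite /decrease mulr0 mul0r.
exact/ltW/decrease_gt0.
Qed.

Lemma decrease_le c c' a a' b b' h h' D D' :
  0 < c -> 0 < a -> 0 < b -> 0 < h -> 0 < D ->
  c <= c' -> a <= a' -> b <= b' -> h <= h' -> D <= D' ->
  decrease c a b h D <= decrease c' a' b' h' D'.
Proof.
move=> c0 a0 b0 h0 D0 cc aa bb hh DD; rewrite ler_pM//.
- by rewrite ltW// mulr_gt0.
- by rewrite !le_min (ltW b0) (ltW D0) ltW// mulr_gt0.
- by rewrite ler_pM// ltW.
- have ah : a * h <= a' * h' by rewrite ler_pM// ltW.
  by rewrite !le_min !ge_min ah bb DD !orbT.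
Qed.

Lemma decrease_small c a b h D : D <= b -> D <= a * h ->
  decrease c a b h D = c * h * D.
Proof. by move=> Db Dah; rewrite /decrease (min_r Db) min_r. Qed.

End Decrease.

(** After [n] descents the sequence is [n * d] below [u K], hence below [l] once [n] exceeds
    [(u K - l) / d]. This serves both for radii and for objective values. *)
Lemma no_linear_descent {R : realType} (u : nat -> R) (l d : R) (K : nat) :
  0 < d -> (forall k, (K <= k)%N -> l <= u k) ->
  ~ (forall k, (K <= k)%N -> exists2 k', (K <= k')%N & u k' <= u k - d).
Proof.
move=> d0 ul desc.
have descn n : exists2 k, (K <= k)%N & u k <= u K - n%:R * d.
  elim: n => [|n [k Kk ukn]]; first by exists K => //; rewrite mul0r subr0.
  have [k' Kk' uk'] := desc k Kk; exists k' => //.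
  by rewrite -natr1 mulrDl mul1r; lra.
have [k Kk ukn] := descn (Num.truncn ((u K - l) / d)).+1.
have := ul k Kk; have := truncnS_gt ((u K - l) / d).
rewrite ltr_pdivrMr//; lra.
Qed.

(** * Trust-region analysis of one call *)

Section Trajectories.
Context {R : realType} (H : hierarchy R) (A : parameters R) (kappaH : R).
Hypothesis hH : hierarchy_ok H.
Hypothesis kappaH_ge1 : 1 <= kappaH.
Hypothesis hF : forall (i : nat) (phi : 'cV[R]_(ldim H i) -> \bar R),
  level_phi phi -> level_ok kappaH phi.
Hypothesis hA : parameters_ok (nlev H) A.

(* The two facts about a step that the analysis of a call needs: the sufficient
   decrease of the model, known only when the predicted decrease is not zero
   (a recursive call may return its starting point), and the great success of
   every step taken within a radius small compared with [h]. *)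
Definition good_step i (a b c : R) (pb : problem H i) x (D : R)
    (m : 'cV[R]_(ldim H i) -> \bar R) s : Prop :=
  let pred := fine (m x - m (x + s)%R)%E in
  let h := hmeas A pb x in
  [/\ enorm s <= D, edom (nonsmooth pb) (x + s), 0 <= pred,
      0 < pred -> decrease c a b h D <= pred
    & 0 < h -> D <= b -> D <= a * h ->
        0 < pred /\ eta2 A * pred <= objval pb x - objval pb (x + s)].

(** The constants are fixed before the problem, the point and the radius: this uniformity over calls
    is what the next level relies on. *)
Definition good_level i (a b c : R) : Prop :=
  forall (pb : problem H i) x D m s,
    admissible pb -> edom (nonsmooth pb) x -> 0 < D ->
    rmntr_step A pb x D m s -> good_step a b c pb x D m s.

Section Call.
Context (i : nat) (ilen : (i <= nlev H)%N) (a b c : R).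
Hypotheses (a0 : 0 < a) (b0 : 0 < b) (c0 : 0 < c) (hgood : good_level i a b c).
Context (pb : problem H i) (pb_adm : admissible pb) (x0 : 'cV[R]_(ldim H i)).
Hypothesis x0D : edom (nonsmooth pb) x0.
Context (Dup : \bar R) (Dup_gt0 : (0 < Dup)%E) (tr : trajectory H i).
Local Notation dom := (edom (nonsmooth pb)).
Local Notation step := (@rmntr_step R H A i).
Local Notation h k := (hmeas A pb (pt tr k)).
Local Notation val k := (objval pb (pt tr k)).

Lemma ratioE k : dom (pt tr k) -> dom (pt tr k + stp tr k) ->
  ratio pb tr k = (val k - objval pb (pt tr k + stp tr k)) /
    fine (mdl tr k (pt tr k) - mdl tr k (pt tr k + stp tr k)%R)%E.
Proof. by move=> xD sD; rewrite /ratio fineB// (objective_fin hF pb_adm). Qed.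

Lemma iteration_good k : iteration A step pb tr k -> dom (pt tr k) ->
  0 < rad tr k ->
  good_step a b c pb (pt tr k) (rad tr k) (mdl tr k) (stp tr k).
Proof. by move=> [stepk _] xD r0; exact: hgood. Qed.

Lemma iteration_pt k : iteration A step pb tr k -> dom (pt tr k) ->
  0 < rad tr k ->
  dom (pt tr k.+1) /\ enorm (pt tr k.+1 - pt tr k) <= rad tr k.
Proof.
move=> it xD r0; have [sr sD _ _ _] := iteration_good it xD r0.
case: it => _ ->; case: ifP => _; last by rewrite subrr enorm0 ltW.
by rewrite addrAC subrr add0r.
Qed.

Lemma iteration_fail k : iteration A step pb tr k -> ratio pb tr k < eta1 A ->
  pt tr k.+1 = pt tr k.
Proof. by move=> [_ ->]; rewrite ltNge => /negPf ->. Qed.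

Lemma iteration_success k : iteration A step pb tr k -> dom (pt tr k) ->
  0 < rad tr k -> eta1 A <= ratio pb tr k ->
  decrease (eta1 A * c) a b (h k) (rad tr k) <= val k - val k.+1.
Proof.
move=> it xD r0 succ; have [sr sD] := iteration_good it xD r0.
case: (it) => _; rewrite succ => -> pred0 dec _.
move: succ; rewrite ratioE//; set p := fine _ in pred0 dec *.
have [[eta1_gt0 _ _] _ _ _ _] := hA.
(* A zero predicted decrease makes the ratio x / 0 = 0, below [eta1], so a successful step has
   positive predicted decrease. *)
have [->|p_neq0] := eqVneq p 0; first by rewrite invr0 mulr0 leNgt eta1_gt0.
have p_gt0 : 0 < p by rewrite lt_def p_neq0.
rewrite ler_pdivlMr// => /(le_trans _); apply.
by rewrite /decrease -2!(mulrA (eta1 A)) ler_pM2l//; exact: dec.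
Qed.

Lemma iteration_small k : iteration A step pb tr k -> dom (pt tr k) ->
  0 < rad tr k -> 0 < h k -> rad tr k <= b -> rad tr k <= a * h k ->
  eta2 A <= ratio pb tr k.
Proof.
move=> it xD r0 h0 rb rah; have [_ sD _ _ []//] := iteration_good it xD r0.
by move=> p0 ?; rewrite ratioE// ler_pdivlMr.
Qed.

Lemma iteration_decrease k : iteration A step pb tr k -> dom (pt tr k) ->
  0 < rad tr k -> val k.+1 <= val k.
Proof.
move=> it xD r0; have [succ|fail] := leP (eta1 A) (ratio pb tr k); last first.
  by rewrite (iteration_fail it fail).
rewrite -subr_ge0; apply: le_trans (iteration_success it xD r0 succ).
have [[eta1_gt0 _ _] _ [_ _ t_gt0] _ _] := hA.
by apply: decrease_ge0 => //; [exact: mulr_gt0|exact: hmeas_ge0].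
Qed.

Lemma notstops_norm k : ~ stops A pb Dup tr k ->
  ((enorm (pt tr k.+1 - pt tr 0%N))%:E <= (1 - epsD A i)%:E * Dup)%E.
Proof.
by move=> ns; rewrite leNgt; apply/negP => lt; apply: ns; right; rewrite lnormE.
Qed.

Lemma radius_trial k : radius_update A pb Dup tr k -> 0 < rad tr k ->
  exists Dp, [/\ gamma1 A * rad tr k <= Dp,
    eta2 A <= ratio pb tr k -> rad tr k <= Dp,
    ratio pb tr k < eta1 A -> Dp <= gamma2 A * rad tr k
    & (rad tr k.+1)%:E =
       Order.min Dp%:E (Dup - (enorm (pt tr k.+1 - pt tr 0%N))%:E)%E].
Proof.
have [[e1 e12 e2] [g1 g12 g2 g3] _ _ _] := hA.
move=> [Dp []]; rewrite lnormE// => p1 p2 p3 E r0.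
have g1r : gamma1 A * rad tr k <= rad tr k.
  by rewrite ger_pMl//; lra.
have g2r : gamma1 A * rad tr k <= gamma2 A * rad tr k by rewrite ler_pM2r.
exists Dp; split=> //; last 2 first.
- by move=> /p1/andP[].
- by move=> /p3/andP[].
have [hi|hi] := leP (eta2 A) (ratio pb tr k).
  by have /andP[+ _] := p1 hi; exact: le_trans.
have [lo|lo] := leP (eta1 A) (ratio pb tr k); last by have /andP[] := p3 lo.
have : eta1 A <= ratio pb tr k < eta2 A by rewrite lo.
by move=> /p2/andP[+ _]; exact: le_trans.
Qed.

Lemma radius_shrink k : radius_update A pb Dup tr k -> 0 < rad tr k ->
  ratio pb tr k < eta1 A -> rad tr k.+1 <= gamma2 A * rad tr k.
Proof.
move=> up r0 fail; have [Dp [_ _ /(_ fail) DpD E]] := radius_trial up r0.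
by rewrite -lee_fin E ge_min lee_fin DpD.
Qed.

(** A radius above [b] or [a * h] loses at most the factor [gamma1]; a smaller one gives a very
    successful step and does not shrink. So the floor [w] survives if [Dup] leaves room for it,
    which is the last hypothesis. *)
Lemma radius_lower k (w : R) : iteration A step pb tr k ->
  radius_update A pb Dup tr k -> dom (pt tr k) ->
  0 < rad tr k -> 0 < h k ->
  w <= rad tr k -> w <= gamma1 A * b -> w <= gamma1 A * (a * h k) ->
  ((w + enorm (pt tr k.+1 - pt tr 0%N))%:E <= Dup)%E -> w <= rad tr k.+1.
Proof.
move=> it up xD r0 h0 wr wb wah wD.
have [_ [g1 g12 g2 g3] _ _ _] := hA.
have [Dp [g1Dp hiDp _ E]] := radius_trial up r0.
rewrite -lee_fin E le_min; apply/andP; split; last by rewrite leeBrDr.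
rewrite lee_fin; have [rb|rb] := leP (rad tr k) b; last first.
  by apply: le_trans g1Dp; apply: le_trans wb _; rewrite ler_pM2l// ltW.
have [rah|rah] := leP (rad tr k) (a * h k); last first.
  by apply: le_trans g1Dp; apply: le_trans wah _; rewrite ler_pM2l// ltW.
by apply: le_trans wr _; apply: hiDp; exact: iteration_small.
Qed.

Lemma radius_inv k : ~ stops A pb Dup tr k -> radius_update A pb Dup tr k ->
  0 < rad tr k ->
  0 < rad tr k.+1 /\
  ((rad tr k.+1 + enorm (pt tr k.+1 - pt tr 0%N))%:E <= Dup)%E.
Proof.
move=> /notstops_norm ns up r0.
have [_ [g1 g12 g2 g3] _ Ds _] := hA.
have [_ /andP[e0 e1]] := Ds i ilen.
have [Dp [g1Dp _ _ E]] := radius_trial up r0.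
split; last by rewrite EFinD -leeBrDr// E ge_min lexx orbT.
rewrite -lte_fin E lt_min; apply/andP; split.
  by rewrite lte_fin (lt_le_trans _ g1Dp) ?mulr_gt0.
(* For finite [Dup], not stopping keeps the distance to the start at most [(1 - epsD A i) * Dup],
   strictly below [Dup]. *)
rewrite sube_gt0; case: Dup Dup_gt0 ns => [D| |]; [|by move=> _ _; rewrite ltry|by []].
by rewrite !lte_fin -EFinM lee_fin => D0 /le_lt_trans; apply; rewrite gtr_pMl//; lra.
Qed.

Lemma reaches_inv N : reaches A step pb x0 Dup tr N -> forall k, (k <= N)%N ->
  [/\ dom (pt tr k), 0 < rad tr k &
    ((rad tr k + enorm (pt tr k - x0))%:E <= Dup)%E].
Proof.
move=> [px0 r0 it]; have [_ _ _ Ds _] := hA.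
elim=> [_|k IH kN].
  rewrite px0 subrr enorm0 addr0; split=> //.
    by rewrite -lte_fin r0 lt_min Dup_gt0 andbT lte_fin; have [] := Ds i ilen.
  by rewrite r0 ge_min lexx orbT.
have [xD rk0 _] := IH (ltnW kN); have [itk nsk upk] := it k kN.
have [? ?] := radius_inv nsk upk rk0.
by split=> //; [have [] := iteration_pt itk xD rk0 | rewrite -px0].
Qed.

Lemma returns_iteration N : returns_at A step pb x0 Dup tr N ->
  forall k, (k <= N)%N ->
  [/\ iteration A step pb tr k, dom (pt tr k) & 0 < rad tr k].
Proof.
move=> [rN itN _] k kN; have [? ? _] := reaches_inv rN kN; split=> //.
move: kN; rewrite leq_eqVlt => /predU1P[->//|kN].
by case: rN => _ _ /(_ k kN)[].
Qed.

(** By [reaches_inv] the last trust region lies in the ball of radius [Dup] around [x0]. The output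
    is iterate [N.+1], since the stopping test follows the step. *)
Lemma returns_ball N : returns_at A step pb x0 Dup tr N ->
  dom (pt tr N.+1) /\ ((enorm (pt tr N.+1 - x0))%:E <= Dup)%E.
Proof.
move=> ret; have [itN xD r0] := returns_iteration ret (leqnn N).
have [sD sr] := iteration_pt itN xD r0; split=> //.
have [rN _ _] := ret; have [_ _] := reaches_inv rN (leqnn N).
apply: le_trans; rewrite lee_fin.
rewrite -(subrK (pt tr N) (pt tr N.+1)) -addrA.
by apply: le_trans (enormD _ _) _; rewrite lerD2r.
Qed.

Lemma returns_decrease N : returns_at A step pb x0 Dup tr N ->
  forall j k, (j <= k)%N -> (k <= N.+1)%N -> val k <= val j.
Proof.
move=> ret j; elim=> [|k IH]; first by rewrite leqn0 => /eqP ->.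
rewrite leq_eqVlt => /predU1P[->//|jk kN].
have [it xD r0] := returns_iteration ret kN.
by apply: le_trans (iteration_decrease it xD r0) (IH jk (ltnW kN)).
Qed.

(** Until the first success the iterate stays at [x0], so [h] is unchanged and the floor [w]
    persists by [radius_lower]. The first success then yields the bound and later iterations keep
    it; the strict inequality forces a success to occur. *)
Lemma returns_first_success N (w : R) : returns_at A step pb x0 Dup tr N ->
  0 < hmeas A pb x0 -> 0 < w -> w <= rad tr 0 -> w <= gamma1 A * b ->
  w <= gamma1 A * (a * hmeas A pb x0) -> (w%:E <= Dup)%E ->
  val N.+1 < objval pb x0 ->
  decrease (eta1 A * c) a b (hmeas A pb x0) w <= objval pb x0 - val N.+1.
Proof.
move=> ret h0 w_gt0 w0 wb wah wD lt.
have [[px0 _ reach] _ _] := ret.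
have [[eta1_gt0 _ _] _ _ _ _] := hA.
set bound := (X in X <= _).
have success k : (k <= N)%N -> pt tr k = x0 -> w <= rad tr k ->
    eta1 A <= ratio pb tr k -> bound <= objval pb x0 - val k.+1.
  move=> kN pk wk succ; have [it xD r0] := returns_iteration ret kN.
  have := iteration_success it xD r0 succ; rewrite pk; apply: le_trans.
  by apply: decrease_le => //; exact: mulr_gt0.
have progress : forall k, (k <= N)%N -> pt tr k = x0 /\ w <= rad tr k \/
    bound <= objval pb x0 - val k.
  elim=> [|k IH] kN; first by left; rewrite px0.
  have [it xD r0] := returns_iteration ret (ltnW kN).
  have [_ ns up] := reach k kN.
  have [[pk wk]|] := IH (ltnW kN); last first.
    by move=> /le_trans le; right; apply: le; rewrite lerB// iteration_decrease.
  have [succ|fail] := leP (eta1 A) (ratio pb tr k).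
    by right; apply: success => //; exact: ltnW.
  left; have pk1 : pt tr k.+1 = x0 by rewrite (iteration_fail it fail).
  split=> //; move: h0 wah; rewrite -pk => h0 wah.
  apply: (radius_lower it up xD r0 h0 wk wb wah).
  by rewrite pk1 px0 subrr enorm0 addr0.
have [it xD r0] := returns_iteration ret (leqnn N).
have [[pN wN]|] := progress N (leqnn N); last first.
  by move=> /le_trans le; apply: le; rewrite lerB// iteration_decrease.
have [succ|fail] := leP (eta1 A) (ratio pb tr N); first exact: success.
by move: lt; rewrite (iteration_fail it fail) pN ltxx.
Qed.

(** Iteration 0 is already very successful, and no later iteration raises the objective. *)
Lemma returns_small_success N : returns_at A step pb x0 Dup tr N ->
  0 < hmeas A pb x0 -> rad tr 0 <= b -> rad tr 0 <= a * hmeas A pb x0 ->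
  val N.+1 < objval pb x0.
Proof.
move=> ret; have [[px0 _ _] _ _] := ret; rewrite -px0 => h0 rb rah.
have [it xD r0] := returns_iteration ret (leq0n N).
have [[e1 e12 _] _ _ _ _] := hA.
have succ : eta1 A <= ratio pb tr 0.
  by apply: le_trans (ltW e12) _; exact: iteration_small.
apply: le_lt_trans (returns_decrease ret (leq0n N : (1 <= N.+1)%N) (leqnn _)) _.
rewrite -subr_gt0; apply: lt_le_trans (iteration_success it xD r0 succ).
by apply: decrease_gt0 => //; exact: mulr_gt0.
Qed.

Lemma infinite_call_false (K : nat) (e l : R) :
  (forall N, reaches A step pb x0 Dup tr N) -> 0 < e ->
  (forall k, (K <= k)%N -> e <= h k) ->
  (forall k, (K <= k)%N -> l <= val k) -> False.
Proof.
move=> inf e0 he hl.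
have [[eta1_gt0 _ _] [g1 g12 g2 g3] _ Ds _] := hA.
have [_ /andP[e0' e1]] := Ds i ilen.
have px0 : pt tr 0 = x0 by have [] := inf 0.
have inv k : [/\ dom (pt tr k), 0 < rad tr k, iteration A step pb tr k,
    ~ stops A pb Dup tr k & radius_update A pb Dup tr k].
  have [? ? _] := reaches_inv (inf k) (leqnn k).
  by have [_ _ /(_ k (ltnSn k))[]] := inf k.+1.
(* The floor [w] collects everything [radius_lower] asks for, with [h] replaced by its lower bound
   [e]. *)
have [w [w0 wK wle]] : exists w, [/\ 0 < w, w <= rad tr K &
    [/\ w <= gamma1 A * b, w <= gamma1 A * (a * e) &
     forall k, ((w + enorm (pt tr k.+1 - pt tr 0%N))%:E <= Dup)%E]].
  (* Never stopping leaves a reserve [epsD A i * D] inside a finite upper radius [D]; for an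
     infinite one any positive number serves. *)
  have [d d0 hd] : exists2 d, 0 < d &
      forall k, ((d + enorm (pt tr k.+1 - pt tr 0%N))%:E <= Dup)%E.
    have norm k := notstops_norm (let: And5 _ _ _ ns _ := inv k in ns).
    case: Dup Dup_gt0 norm => [D| |]//; last by exists 1 => // k; rewrite leey.
    rewrite lte_fin => D0 norm; exists (epsD A i * D); first exact: mulr_gt0.
    by move=> k; have := norm k; rewrite -EFinM !lee_fin mulrBl mul1r; lra.
  exists (Num.min (Num.min (rad tr K) d)
                  (Num.min (gamma1 A * b) (gamma1 A * (a * e)))); split.
  - by rewrite !lt_min d0 !mulr_gt0//; have [_ -> _ _ _] := inv K.
  - by rewrite !ge_min lexx.
  - split; rewrite ?ge_min ?lexx ?orbT// => k; apply: le_trans (hd k).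
    by rewrite lee_fin lerD2r !ge_min lexx orbT.
have [wb wae wnorm] := wle.
have wrad k : (K <= k)%N -> w <= rad tr k.
  elim: k => [|k IH]; first by rewrite leqn0 => /eqP <-.
  rewrite leq_eqVlt => /predU1P[<-//|Kk]; have [xD r0 it ns up] := inv k.
  have hk := he k Kk.
  apply: radius_lower => //; [exact: lt_le_trans hk|exact: IH|].
  by apply: le_trans wae _; rewrite ler_pM2l// ler_pM2l.
(* Without further success the radius would drop by at least [(1 - gamma2 A) * w] at each iteration
   while staying above [w]. *)
have next k : (K <= k)%N -> exists2 k', (k <= k')%N & eta1 A <= ratio pb tr k'.
  move=> Kk; apply/not_exists2P => nosucc.
  have fail k' : (k <= k')%N -> ratio pb tr k' < eta1 A.
    by move=> kk'; have [//|lo] := nosucc k'; rewrite ltNge; apply/negP.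
  have dw : 0 < (1 - gamma2 A) * w by rewrite mulr_gt0// subr_gt0.
  apply: (no_linear_descent (u := rad tr) (K := k) (l := w) dw) => k' kk'.
    by apply: wrad; exact: leq_trans kk'.
  exists k'.+1; first exact: leqW.
  have [xD r0 it ns up] := inv k'.
  apply: le_trans (radius_shrink up r0 (fail k' kk')) _.
  have : (1 - gamma2 A) * w <= (1 - gamma2 A) * rad tr k'.
    by rewrite ler_pM2l ?subr_gt0// wrad// (leq_trans Kk).
  lra.
have mono j k : (j <= k)%N -> val k <= val j.
  elim: k => [|k IH]; first by rewrite leqn0 => /eqP ->.
  rewrite leq_eqVlt => /predU1P[->//|jk]; have [xD r0 it _ _] := inv k.
  exact: le_trans (iteration_decrease it xD r0) (IH jk).
set d := decrease (eta1 A * c) a b e w.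
have d0 : 0 < d by apply: decrease_gt0 => //; exact: mulr_gt0.
apply: (no_linear_descent (u := fun k => val k) (K := K) (l := l) d0) => // k Kk.
have [k' kk' succ] := next k Kk; have Kk' := leq_trans Kk kk'.
exists k'.+1; first exact: leqW.
have [xD r0 it _ _] := inv k'; have hk := he k' Kk'.
suff : d <= val k' - val k'.+1 by have := mono k k' kk'; lra.
apply: le_trans (iteration_success it xD r0 succ).
by apply: decrease_le => //; [exact: mulr_gt0|exact: wrad].
Qed.

End Call.

(** * Induction over the levels *)

Section LevelInduction.
Local Notation eps1 := (1 - eta2 A).

(** A model error of at most [(1 - eta2 A) * pred] gives a ratio of at least [eta2 A]; the bound on
    [a] is chosen to make the error [2 * kappaH * D ^+ 2] that small. *)
Lemma model_error_le (a c h D pred : R) : 0 < 1 - eta2 A -> 0 <= h -> 0 < D ->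
  a <= eps1 * c / (2 * kappaH) -> D <= a * h -> c * h * D <= pred ->
  2 * kappaH * D ^+ 2 <= eps1 * pred.
Proof.
move=> e0 h0 D0 aerr Dah predD.
apply: le_trans (_ : eps1 * (c * h * D) <= _); last by rewrite ler_pM2l.
have : D <= eps1 * c / (2 * kappaH) * h by apply: le_trans Dah _; rewrite ler_wpM2r.
rewrite mulrAC ler_pdivlMr ?mulr_gt0 ?(lt_le_trans _ kappaH_ge1)// => Dle.
by have := ler_wpM2r (ltW D0) Dle; rewrite expr2; lra.
Qed.

Lemma taylor_good i (a b c : R) (pb : problem H i) x (D : R) m s :
  (i <= nlev H)%N -> 0 < a -> 0 < b -> 0 < c -> c <= kfcd A ->
  a <= kappaH^-1 -> a <= eps1 * c / (2 * kappaH) ->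
  admissible pb -> edom (nonsmooth pb) x -> 0 < D ->
  taylor_step A pb x D m s -> good_step a b c pb x D m s.
Proof.
move=> ilen a0 b0 c0 ck ak aerr pb_adm xD D0 [mE sD dec].
have [[_ _ e2] _ [_ k0 t_gt0] _ _] := hA.
have kH0 : 0 < kappaH by exact: lt_le_trans kappaH_ge1.
have phix := nonsmooth_fin hF pb_adm xD.
have mx : m x = (smooth pb x + fine (nonsmooth pb x))%:E.
  have := mE 0; rewrite mulmx0 !dotv0 !addr0 mulr0 addr0 => ->.
  by rewrite [RHS]EFinD fineK.
move: sD dec; rewrite lnormE// levelM1// => sD dec.
(* An infinite value at the trial point would make the predicted decrease [-oo], against the
   decrease condition. *)
have sdom : edom (nonsmooth pb) (x + s).
  rewrite /edom /= ltNge leye_eq; apply/negP => /eqP phiy.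
  by move: dec; rewrite mx mE phiy.
have phiy := nonsmooth_fin hF pb_adm sdom.
have my : m (x + s) = (smooth pb x + dotv (grad (smooth pb) x) s +
    2^-1 * dotv (lB H x *m s) s + fine (nonsmooth pb (x + s)))%:E.
  by rewrite mE [RHS]EFinD fineK.
have tay := smooth_taylor hF pb_adm xD sdom.
have bB := lB_bound hF pb_adm xD.
have oB := opnorm_ge0 (lB H x).
have quad := dotv_mulmx (lB H x) s.
have h0 := hmeas_ge0 pb x t_gt0.
rewrite /good_step !(objvalE hF pb_adm)//; move: dec.
rewrite mx my -EFinB lee_fin /=.
set pred := _ - _; set h := hmeas A pb x in h0 *.
set o := opnorm _ _ in bB oB quad * => dec; clearbody h.
have s2 : enorm s ^+ 2 <= D ^+ 2 by rewrite ler_sqr ?nnegrE ?enorm_ge0// ltW.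
have dec' : kfcd A * h * Num.min (h / kappaH) D <= pred.
  apply: le_trans dec; apply: ler_wpM2l; first by rewrite mulr_ge0// ltW.
  have ho : h / kappaH <= h / (1 + o) by rewrite ler_wpM2l// lef_pV2 ?posrE//; lra.
  by rewrite !le_min !ge_min ho lexx orbT.
have pred0 : 0 <= pred.
  by apply: le_trans dec'; rewrite !mulr_ge0 ?le_min ?divr_ge0// ltW.
have decr : decrease c a b h D <= pred.
  apply: le_trans dec'; rewrite /decrease; apply: ler_pM.
  - by rewrite mulr_ge0// ltW.
  - by rewrite !le_min mulr_ge0 ?(ltW a0) ?(ltW b0) ?(ltW D0).
  - by rewrite ler_wpM2r.
  - have ah : a * h <= h / kappaH by rewrite mulrC ler_wpM2l.
    by rewrite !le_min !ge_min ah lexx !orbT.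
split=> // h_gt0 Db Dah.
have predD : c * h * D <= pred by rewrite -(decrease_small c Db Dah).
split; first by apply: lt_le_trans predD; rewrite !mulr_gt0.
have err : 2 * kappaH * D ^+ 2 <= eps1 * pred.
  by apply: model_error_le aerr Dah predD; rewrite ?subr_gt0.
have e0 : 0 <= enorm s ^+ 2 by rewrite exprn_ge0// enorm_ge0.
(* The model error is the Taylor remainder minus half the quadratic form; both are of order
   [kappaH * D ^+ 2]. *)
have quad2 : `|dotv (lB H x *m s) s| <= kappaH * D ^+ 2.
  by apply: le_trans quad _; rewrite ler_pM//; lra.
have tay2 : `|smooth pb (x + s) - smooth pb x - dotv (grad (smooth pb) x) s| <=
    kappaH * D ^+ 2.
  by apply: le_trans tay _; rewrite ler_pM2l.
move: quad2 tay2 err pred0; rewrite !ler_norml /pred => /andP[q1 q2] /andP[t1 t2].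
have : 0 <= kappaH * D ^+ 2 by rewrite mulr_ge0 ?ltW// exprn_gt0.
lra.
Qed.

(** The factor [kstop] passes from [h] at the start of the call to the current [h], [gamma1] pays
    for the radius floor before the first success, and [eta1] for actual against predicted
    decrease. *)
Lemma coarse_good i (a b c a' b' c' : R) (pb : problem H i.+1) x (D : R) m s :
  (i < nlev H)%N -> 0 < a -> 0 < b -> 0 < c -> good_level i a b c ->
  0 < a' -> 0 < b' -> 0 < c' ->
  b' <= gamma1 A * b -> b' <= Dstart A i ->
  a' <= kstop A * (gamma1 A * a) -> c' <= kstop A * (eta1 A * c) ->
  a' <= eps1 * c' / (2 * kappaH) ->
  admissible pb -> edom (nonsmooth pb) x -> 0 < D ->
  recurses A pb x ->
  (exists (tr : trajectory H i) (N : nat),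
     [/\ returns_at A (@rmntr_step R H A i) (coarse_problem pb x)
           (restr H i *m x) D%:E tr N,
         s = prol H i *m (pt tr N.+1 - restr H i *m x)
       & forall v, m (x + prol H i *m v) =
           objective (coarse_problem pb x) (restr H i *m x + v)]) ->
  good_step a' b' c' pb x D m s.
Proof.
move=> ilt a0 b0 c0 good a'0 b'0 c'0 b'b b'D a'a c'c a'err pb_adm xD D0 [hrec hpos].
move=> [tr [N [ret sE mE]]].
have [[e1 e12 e2] [g1 g12 g2 g3] [/andP[k0 k1] _ t_gt0] Ds epsh0] := hA.
have kH0 : 0 < kappaH by exact: lt_le_trans kappaH_ge1.
set y0 := restr H i *m x in ret sE mE hrec hpos.
set pb0 := coarse_problem pb x in ret mE hrec hpos.
have pb0_adm : admissible pb0 by exact: admissible_coarse.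
have y0D : edom (nonsmooth pb0) y0 by rewrite edom_coarse0.
have ilen := ltnW ilt.
have Dup0 : (0 < D%:E :> \bar R)%E by rewrite lte_fin.
(* Recursion demands [epsh A i <= h0], and this tolerance is positive below the top level. *)
have h0_gt0 : 0 < hmeas A pb0 y0.
  by have /andP[e0 _] := epsh0 i ilt; exact: lt_le_trans hpos.
have [yD] := returns_ball ilen good pb0_adm y0D Dup0 ret.
rewrite lee_fin => sD.
set v := pt tr N.+1 - y0 in sE sD.
have yE : pt tr N.+1 = y0 + v by rewrite addrC subrK.
have sdom : edom (nonsmooth pb) (x + s) by rewrite sE -edom_coarse -/pb0 -/y0 -yE.
have es : enorm s = enorm v.
  by rewrite sE enorm_isom//; exact: prol_isom.
have mx : m x = objective pb0 y0.
  by have := mE 0; rewrite mulmx0 !addr0.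
have my : m (x + s) = objective pb0 (pt tr N.+1) by rewrite sE mE -yE.
rewrite /good_step mx my fineB ?(objective_fin hF pb0_adm)//.
rewrite -/(objval pb0 y0) -/(objval pb0 (pt tr N.+1)).
have px0 : pt tr 0 = y0 by have [[]] := ret.
have r0E : rad tr 0 = Num.min (Dstart A i) D.
  by have [[_ + _] _ _] := ret; rewrite -EFin_min => -[].
have pred0 : 0 <= objval pb0 y0 - objval pb0 (pt tr N.+1).
  rewrite subr_ge0 -px0. 
  exact: (returns_decrease ilen a0 b0 c0 good pb0_adm y0D Dup0 ret
    (leq0n N.+1) (leqnn _)).
have first w := returns_first_success (w := w) ilen a0 b0 c0 good
  pb0_adm y0D Dup0 ret h0_gt0.
have small := returns_small_success ilen a0 b0 c0 good
  pb0_adm y0D Dup0 ret h0_gt0.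
have hh0 := hmeas_ge0 pb x t_gt0.
have Dsi : 0 < Dstart A i by have [] := Ds i ilen.
(* The nonsmooth values agree and, by [grad_coarse], so do the first-order terms; two Taylor
   remainders are left. *)
have model_err : `|objval pb x - objval pb (x + s) -
    (objval pb0 y0 - objval pb0 (pt tr N.+1))| <= 2 * kappaH * D ^+ 2.
  have tay := smooth_taylor hF pb_adm xD sdom.
  have yD' : edom (nonsmooth pb0) (y0 + v) by rewrite -yE.
  have tay0 := smooth_taylor hF pb0_adm y0D yD'.
  have gradE : dotv (grad (smooth pb0) y0) v = dotv (grad (smooth pb) x) s.
    by rewrite sE dotv_mull (grad_coarse hF)// /prol trmxK.
  rewrite yE !(objvalE hF pb_adm)// !(objvalE hF pb0_adm)//.
  have -> : nonsmooth pb0 (y0 + v) = nonsmooth pb (x + s).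
    by rewrite sE -coarse_phi_add.
  have -> : nonsmooth pb0 y0 = nonsmooth pb x.
    by rewrite -[y0]addr0 coarse_phi_add mulmx0 addr0.
  have v2 : kappaH * enorm v ^+ 2 <= kappaH * D ^+ 2.
    by rewrite ler_pM2l// ler_sqr ?nnegrE ?enorm_ge0// ltW.
  move: tay tay0; rewrite gradE es !ler_norml => /andP[? ?] /andP[? ?].
  by apply/andP; split; lra.
move: model_err pred0 first small hrec h0_gt0 hh0.
move: (objval pb0 y0) (objval pb0 (pt tr N.+1)) (hmeas A pb x) (hmeas A pb0 y0).
move=> L0 L1 h h0 model_err pred0 first small hrec h0_gt0 hh0.
have a'h : a' * h <= gamma1 A * (a * h0).
  apply: le_trans (_ : gamma1 A * a * (kstop A * h) <= _).
    by rewrite mulrCA mulrA ler_wpM2r.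
  by rewrite -mulrA ler_pM2l// ler_pM2l.
have g1a : gamma1 A * (a * h0) <= a * h0 by rewrite ger_pMl ?mulr_gt0//; lra.
have g1b : gamma1 A * b <= b by rewrite ger_pMl//; lra.
have c'h : c' * h <= eta1 A * c * h0.
  apply: le_trans (_ : eta1 A * c * (kstop A * h) <= _).
    by rewrite mulrCA mulrA ler_wpM2r.
  by rewrite ler_pM2l// mulr_gt0.
have decr : 0 < L0 - L1 -> decrease c' a' b' h D <= L0 - L1.
  rewrite subr_gt0 => lt.
  (* The largest floor that [returns_first_success] admits: the initial radius of the call capped by
     its [gamma1] bounds and by the upper radius [D]. *)
  pose w := Num.min (Num.min (Dstart A i) D)
                    (Num.min (gamma1 A * b) (gamma1 A * (a * h0))).
  apply: le_trans (first w _ _ _ _ _ lt).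
  - rewrite ler_pM ?mulr_ge0 ?(ltW c'0)//.
      by rewrite !le_min mulr_ge0 ?(ltW a'0) ?(ltW b'0) ?(ltW D0).
    set mi := Num.min (a' * h) _.
    have mia : mi <= gamma1 A * (a * h0) by rewrite ge_min a'h.
    have mib : mi <= b' by rewrite !ge_min lexx !orbT.
    have miD : mi <= D by rewrite !ge_min lexx !orbT.
    by rewrite !le_min (le_trans mia)// (le_trans mib (le_trans b'b g1b))
      (le_trans mib b'D) miD (le_trans mib b'b) mia.
  - by rewrite !lt_min Dsi D0 !mulr_gt0.
  - by rewrite r0E /w ge_min lexx.
  - by rewrite /w !ge_min lexx !orbT.
  - by rewrite /w !ge_min lexx !orbT.
  - by rewrite lee_fin /w !ge_min lexx !orbT.
split=> //; first by rewrite es.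
move=> h_gt0 Db Dah.
have pred_gt0 : 0 < L0 - L1.
  rewrite subr_gt0; apply: small; rewrite r0E.
    by rewrite ge_min (le_trans Db (le_trans b'b g1b)) orbT.
  by rewrite ge_min (le_trans Dah (le_trans a'h g1a)) orbT.
split=> //; have := decr pred_gt0; rewrite decrease_small// => predD.
have err : 2 * kappaH * D ^+ 2 <= eps1 * (L0 - L1).
  by apply: model_error_le a'err Dah predD; rewrite ?subr_gt0.
by move: model_err; rewrite ler_norml => /andP[]; lra.
Qed.

Lemma good_level_exists i : (i <= nlev H)%N ->
  exists a b c, [/\ 0 < a, 0 < b, 0 < c & good_level i a b c].
Proof.
have [[e1 e12 e2] [g1 g12 g2 g3] [/andP[k0 k1] kf0 t_gt0] Ds epsh0] := hA.
have kH0 : 0 < kappaH by exact: lt_le_trans kappaH_ge1.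
have eps1_gt0 : 0 < eps1 by rewrite subr_gt0.
elim: i => [|i IH] ilen.
  pose a := Num.min kappaH^-1 (eps1 * kfcd A / (2 * kappaH)).
  have a0 : 0 < a by rewrite lt_min invr_gt0 kH0 divr_gt0 ?mulr_gt0.
  (* Taylor steps ask of [b] only that it be positive. *)
  exists a, 1, (kfcd A); split=> // pb x D m s pb_adm xD D0 /= st.
  by apply: taylor_good => //; rewrite ge_min lexx ?orbT.
have [a [b [c [a0 b0 c0 good]]]] := IH (ltnW ilen).
have [Dsi _] := Ds i (ltnW ilen).
(* The new constants are minima of what Taylor and recursive steps allow; [c'] is fixed before [a'],
   whose last bound involves it. *)
pose b' := Num.min (gamma1 A * b) (Dstart A i).
pose c' := Num.min (kfcd A) (kstop A * (eta1 A * c)).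
have b'0 : 0 < b' by rewrite lt_min Dsi mulr_gt0.
have c'0 : 0 < c' by rewrite lt_min kf0 !mulr_gt0.
pose a' := Num.min (Num.min kappaH^-1 (kstop A * (gamma1 A * a)))
                   (eps1 * c' / (2 * kappaH)).
have a'0 : 0 < a' by rewrite !lt_min invr_gt0 kH0 divr_gt0 ?mulr_gt0.
exists a', b', c'; split=> // pb x D m s pb_adm xD D0 /= [[rec ex]|[_ st]].
- apply: (coarse_good (a := a) (b := b) (c := c)) rec ex => //;
    by rewrite !ge_min lexx ?orbT.
- by apply: taylor_good => //; rewrite !ge_min lexx ?orbT.
Qed.

(** Below the top level, not stopping keeps [h] above the positive tolerance, and the finite radius
    confines the iterates to a ball on which the objective is bounded below. *)
Lemma finite_call i (pb : problem H i) x0 (D : R) (tr : trajectory H i) :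
  (i < nlev H)%N -> admissible pb -> edom (nonsmooth pb) x0 -> 0 < D ->
  ~ (forall N, reaches A (@rmntr_step R H A i) pb x0 D%:E tr N).
Proof.
move=> ilt pb_adm x0D D0 inf; have ilen := ltnW ilt.
have [_ _ _ _ /(_ i ilt)/andP[e0 _]] := hA.
have [a [b [c [a0 b0 c0 good]]]] := good_level_exists ilen.
have Dup0 : (0 < D%:E :> \bar R)%E by rewrite lte_fin.
have [l lb] := objval_lower hF pb_adm x0 D.
apply: (infinite_call_false ilen a0 b0 c0 good pb_adm x0D Dup0
  (K := 0) (l := l) inf e0) => k _.
  have [_ _ /(_ k (ltnSn k))[_ ns _]] := inf k.+1.
  by rewrite leNgt; apply/negP => lt; apply: ns; left; exact: ltW.
have [xD r0] := reaches_inv ilen good pb_adm x0D Dup0 (inf k) (leqnn k).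
by rewrite lee_fin => rD; apply: lb => //; lra.
Qed.

(** Induction on the level: an endless call contradicts [finite_call], and a deeper block starts
    from an iterate that again lies in the domain with positive radius. *)
Lemma not_blocked i (pb : problem H i) x (D : R) :
  (i <= nlev H)%N -> admissible pb -> edom (nonsmooth pb) x -> 0 < D ->
  ~ blocked A pb x D.
Proof.
elim: i pb x D => [|i IH] pb x D ilen pb_adm xD D0; first by [].
move=> /= [_ [tr]].
have pb0_adm := admissible_coarse pb_adm xD.
have y0D : edom (nonsmooth (coarse_problem pb x)) (restr H i *m x).
  by rewrite edom_coarse0.
case=> [|[N rN]]; first exact: finite_call.
have [a [b [c [a0 b0 c0 good]]]] := good_level_exists (ltnW ilen).
have Dup0 : (0 < D%:E :> \bar R)%E by rewrite lte_fin.
have [yD r0 _] := reaches_inv (ltnW ilen) good pb0_adm y0D Dup0 rN (leqnn N).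
by apply: IH => //; exact: ltnW.
Qed.

End LevelInduction.
End Trajectories.

(** * The lower limit at the top level *)

Lemma limn_einf0 {R : realType} (u : nat -> R) : (forall k, 0 <= u k) ->
  (forall e, 0 < e -> forall K, exists2 k, (K <= k)%N & u k < e) ->
  limn_einf (fun k => (u k)%:E) = 0%E.
Proof.
move=> u0 small; rewrite limn_einf_lim; apply: cvg_lim => //.
(* Each tail infimum is already zero, so the sequence of infima is constant. *)
suff -> : einfs (fun k => (u k)%:E) = cst 0%E by exact: cvg_cst.
apply/funext => K; apply/eqP; rewrite eq_le; apply/andP; split.
  apply/lee_addgt0Pr => e e0; rewrite add0e.
  have [k Kk uk] := small e e0 K.
  apply: (@le_trans _ _ (u k)%:E); last by rewrite lee_fin ltW.
  by apply: ereal_inf_lbound; exists k.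
by apply: le_ereal_inf_tmp => _ [k _ <-]; rewrite lee_fin.
Qed.

Theorem corollaryA5 (R : realType) (H : hierarchy R) (A : parameters R) (kappaH : R)
  (hH : hierarchy_ok H)
  (hkappaH : 1 <= kappaH)
  (hF : forall (i : nat) (phi : 'cV[R]_(ldim H i) -> \bar R),
      level_phi phi -> level_ok kappaH phi)
  (hA : parameters_ok (nlev H) A)
  (heps : epsh A (nlev H) = 0)
  (x0 : 'cV[R]_(ldim H (nlev H)))
  (hx0 : edom (top_phi H) x0)
  (tr : trajectory H (nlev H)) (lastk : option nat)
  (hrun : rmntr_run A x0 tr lastk) :
  limn_einf (fun k => (hseq A tr lastk k)%:E) = 0%E.
Proof.
have [_ _ [_ _ t_gt0] Ds _] := hA; have [_ /andP[_ epsD1]] := Ds _ (leqnn (nlev H)).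
have top_adm := admissible_top H.
have [a [b [c [a0 b0 c0 good]]]] := good_level_exists hH hkappaH hF hA (leqnn _).
have inv := reaches_inv hH hA (leqnn _) good top_adm hx0 lt0y (tr := tr).
apply: limn_einf0 => [k|e e0 K]; first exact: hmeas_ge0.
case: lastk hrun => [N|] /= hrun.
  case: hrun => [[_ _ stop]|[rN]]; last first.
    have [xD r0 _] := inv N rN N (leqnn N).
    by move=> /(not_blocked hH hkappaH hF hA (leqnn _) top_adm xD r0).
  (* From iteration [N] on, [hseq] is frozen at the value of iteration [N]. *)
  exists (maxn K N); rewrite ?leq_maxl// /hseq (minn_idPr (leq_maxr _ _)).
  case: stop => [|]; first by rewrite heps => /le_lt_trans; apply.
  (* With infinite upper radius the distance test would need a norm above [+oo], so the run stopped
     because [h <= 0]. *)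
  by rewrite gt0_muley ?lte_fin ?subr_gt0// ltNge leey.
(* Otherwise [h] stays at least [e] from [K] on in a call that never returns, while the top
   objective is bounded below on its domain. *)
apply: contrapT => /forall2NP big.
have [l lb] := top_objval_lower hF.
apply: (infinite_call_false hH hF hA (leqnn _) a0 b0 c0 good top_adm hx0
  lt0y (K := K) (l := l) hrun e0) => k Kk.
  by have [//|/negP] := big k; rewrite -leNgt.
by have [xD _ _] := inv k (hrun k) k (leqnn k); exact: lb.
Qed.
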